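(* Let $d=2^n$, let $k\ge 1$, and let $\mathcal{P}$ be the set of $d^2$ $n$-qubit Pauli operators. For $A_1,\dots,A_k,C_1,\dots,C_k\in\mathcal{P}$ put $$M^{C_1,\dots,C_k}_{A_1,\dots,A_k}=\mathrm{tr}\{A_1C_1A_2C_2\cdots A_kC_k\},$$ and let $M^\dagger$ be its conjugate transpose, ${M^\dagger}^{A_1,\dots,A_k}_{C_1,\dots,C_k}=\overline{M^{C_1,\dots,C_k}_{A_1,\dots,A_k}}$. Then for all $A_1,\dots,A_k,A_1',\dots,A_k'\in\mathcal{P}$, $$\sum_{C_1,\dots,C_k\in\mathcal{P}}{M^\dagger}^{A_1',\dots,A_k'}_{C_1,\dots,C_k}\,M^{C_1,\dots,C_k}_{A_1,\dots,A_k}=d^{2k}\,\delta^{A_1'}_{A_1}\cdots\delta^{A_k'}_{A_k},$$ where $\delta^P_Q=1$ if $P=Q$ and $\delta^P_Q=0$ if $P\neq Q$.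
   Context: $\mathcal{P}$ denotes the set of the $4^n=d^2$ operators on $(\mathbb{C}^2)^{\otimes n}$ of the form $P_1\otimes\cdots\otimes P_n$ with each $P_j\in\{I,X,Y,Z\}$ (the $2\times2$ identity and Pauli matrices), with no additional global phases. The trace is the unnormalized trace on $\mathbb{C}^d$. *)

(* Defs.v *)
From HB Require Import structures.
From mathcomp Require Import all_boot all_order all_algebra.
From mathcomp Require Import finmap reals.
From mathcomp Require Export complex mxtens.

Set Implicit Arguments.
Unset Strict Implicit.
Unset Printing Implicit Defensive.

Import GRing.Theory Num.Theory.
Local Open Scope ring_scope.
Local Open Scope complex_scope.
Local Open Scope fset_scope.

Section PauliOperators.
Variable R : realType.

Definition pauliX : 'M[R[i]]_2 := delta_mx 0 1 + delta_mx 1 0.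
Definition pauliY : 'M[R[i]]_2 := 'i *: (delta_mx 1 0 - delta_mx 0 1).
Definition pauliZ : 'M[R[i]]_2 := delta_mx 0 0 - delta_mx 1 1.

Definition pauli1 : {fset 'M[R[i]]_2} := [fset 1%:M; pauliX; pauliY; pauliZ].

(* P_0 *t (P_1 *t ... *t P_(n-1)), with the 1 x 1 identity for n = 0; the cast
   is needed because 2 ^ n.+1 and 2 * 2 ^ n are equal but not convertible. *)
Fixpoint tens (n : nat) : ('I_n -> 'M[R[i]]_2) -> 'M[R[i]]_(2 ^ n) :=
  match n with
  | 0 => fun=> 1%:M
  | n'.+1 => fun P =>
      castmx (esym (expnS 2 n'), esym (expnS 2 n'))
        (P ord0 *t tens (fun j => P (lift ord0 j)))
  end.

(* A set of matrices, not of labels: the index types and Kronecker deltas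
   below refer to equality of operators. *)
Definition paulis (n : nat) : {fset 'M[R[i]]_(2 ^ n)} :=
  [fset tens (fun j => val (P j)) | P : {ffun 'I_n -> pauli1} in predT].

Definition Mtr (n k : nat) (A C : {ffun 'I_k -> paulis n}) : R[i] :=
  \tr (\big[mulmx/1%:M]_(j < k) (val (A j) *m val (C j))).

Definition Mdag (n k : nat) (C A : {ffun 'I_k -> paulis n}) : R[i] :=
  (Mtr A C)^*.

Definition delta (n : nat) (P Q : paulis n) : R[i] := (P == Q)%:R.

End PauliOperators.

(* Main.v *)
Require Import Defs.
From mathcomp Require Import all_boot all_order all_algebra.
From mathcomp Require Import finmap reals ring.

(* The Pauli operators are orthogonal, and complete in the sense that
   sum_C conj(C_ab) C_ce = d [a = c] [b = e].  Both facts are checked entrywise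
   for one qubit and pass to n qubits because the entries of a tensor product
   are products of entries.  Completeness gives the twirl
   sum_C C^* X C = d tr(X) 1 and the Parseval identity
   sum_C conj(tr(X C)) tr(Y C) = d tr(X^* Y).  Write W for the word
   A_2 C_2 ... A_k C_k.  Parseval in C_1 turns the sum into
   d tr(A'_1^* (sum W'^* W) A_1), and the twirl peels the inner sum from the
   outside in, each step contributing d tr(A'_j^* A_j) = d^2 [A'_j = A_j]. *)

Set Implicit Arguments.
Unset Strict Implicit.
Unset Printing Implicit Defensive.

Import GRing.Theory Num.Theory.
Local Open Scope ring_scope.
Local Open Scope complex_scope.

(** * Tuples of indices and binary digits of basis labels *)

Lemma sum_ffun_recl (V : nmodType) (T : finType) (k : nat)
    (F : T -> {ffun 'I_k -> T} -> V) :
  \sum_(C : {ffun 'I_k.+1 -> T}) F (C ord0) [ffun j => C (lift ord0 j)]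
  = \sum_c \sum_(C : {ffun 'I_k -> T}) F c C.
Proof.
rewrite pair_bigA /=.
pose cons (p : T * {ffun 'I_k -> T}) : {ffun 'I_k.+1 -> T} :=
  [ffun j => if unlift ord0 j is Some j' then p.2 j' else p.1].
have consK (p : T * {ffun 'I_k -> T}) :
    (cons p ord0, [ffun j => cons p (lift ord0 j)]) = p.
  case: p => c C; congr (_, _); first by rewrite ffunE unlift_none.
  by apply/ffunP => j; rewrite !ffunE liftK.
rewrite (reindex cons) /=.
  by apply: eq_bigr => p _; case: (_ p) / (consK p) => /=; rewrite consK.
exists (fun C => (C ord0, [ffun j => C (lift ord0 j)])) => [p _ | C _] //.
apply/ffunP => j; rewrite ffunE.
by case: unliftP => [j' -> | ->] /=; rewrite ?ffunE.
Qed.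

(** The computational basis label of an index. The recursion undoes the cast and the nesting of
    [tens], so that entries of a tensor product factor along the digits. *)
Fixpoint digits (n : nat) : 'I_(2 ^ n) -> {ffun 'I_n -> 'I_2} :=
  match n with
  | 0 => fun=> [ffun=> ord0]
  | n'.+1 => fun i =>
      let p := mxtens_unindex (cast_ord (expnS 2 n') i) in
      [ffun j => if unlift ord0 j is Some j' then digits p.2 j' else p.1]
  end.

Lemma digits_bij (n : nat) : bijective (@digits n).
Proof.
apply: inj_card_bij; last by rewrite card_ffun !card_ord.
elim: n => [|n IHn] i i'; first by rewrite !ord1.
move/ffunP => eq_d.
apply: (can_inj (cast_ordK (expnS 2 n))).
apply: (can_inj (@mxtens_unindexK 2 (2 ^ n))).
have := eq_d ord0; rewrite !ffunE unlift_none => eq1.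
suff eq2 : (mxtens_unindex (cast_ord (expnS 2 n) i)).2
         = (mxtens_unindex (cast_ord (expnS 2 n) i')).2.
  by rewrite [LHS]surjective_pairing eq1 eq2 -surjective_pairing.
apply: IHn; apply/ffunP => j.
by have := eq_d (lift ord0 j); rewrite !ffunE liftK.
Qed.

(** * Orthogonality and completeness of the Pauli operators *)

Section Pauli.
Variable R : realType.

Lemma tensE (n : nat) (P : 'I_n -> 'M[R[i]]_2) a b :
  tens P a b = \prod_(j < n) P j (digits a j) (digits b j).
Proof.
elim: n P a b => [|n IHn] P a b; first by rewrite big_ord0 mxE !ord1.
rewrite big_ord_recl /= castmxE !esymK /= mxE IHn !ffunE unlift_none /=.
by congr (_ * _); apply: eq_bigr => j _; rewrite !ffunE liftK.
Qed.

Lemma pauli1_uniq : uniq [:: pauliZ R; pauliY R; 1%:M; pauliX R].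
Proof.
have i1 : 'i%R != 1 :> R[i] by rewrite -complexiE eq_complex /= oner_eq0 andbF.
have n11 : (-1 : R[i]) != 1 by rewrite eqNr oner_eq0.
rewrite /= !inE !negb_or -!andbA andbT.
apply/and5P; split; last (apply/andP; split).
(* One entry tells each of the six pairs apart: a diagonal one, except for Y and X, whose diagonals
   vanish and which differ by [i1] at (1, 0). *)
all: apply/eqP => /matrixP neq.
- by have /eqP := neq 0 0; rewrite !mxE /= !subr0 mulr0 oner_eq0.
- by have /eqP := neq 1 1; rewrite !mxE /= sub0r (negPf n11).
- by have /eqP := neq 0 0; rewrite !mxE /= subr0 addr0 oner_eq0.
- by have /eqP := neq 0 0; rewrite !mxE /= subr0 mulr0 eq_sym oner_eq0.
- by have /eqP := neq 1 0; rewrite !mxE /= subr0 mulr1 add0r (negPf i1).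
- by have /eqP := neq 0 0; rewrite !mxE /= addr0 oner_eq0.
Qed.

Lemma big_pauli1 (F : 'M[R[i]]_2 -> R[i]) :
  \sum_(p : pauli1 R) F (val p)
  = F (pauliZ R) + (F (pauliY R) + (F 1%:M + F (pauliX R))).
Proof.
have := pauli1_uniq => /= /and4P[nZ nY n1 _].
(* The unions in [pauli1] nest to the left; commuting them brings Z, then Y, to the front, hence the
   order Z, Y, 1, X. *)
rewrite -(big_seq_fsetE _ _ predT F) /pauli1 /= fsetUC.
rewrite (fsetUC _ [fset pauliY R]%fset).
by rewrite !big_fsetU1 ?big_seq_fset1 //= !inE; move: nZ nY n1; rewrite !inE.
Qed.

Lemma ord2_cases (x : 'I_2) : x = 0 \/ x = 1.
Proof. by case: x => [[|[|]]] //= lt; [left | right]; apply: val_inj. Qed.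

(** The entries of the four matrices, divided by the square root of 2, form a unitary 4 by 4 table;
    this is orthogonality of its columns, [pauli1_orth] that of its rows. *)
Lemma pauli1_complete (x y z t : 'I_2) :
  \sum_(p : pauli1 R) (val p x y)^* * val p z t = 2 * ((x, y) == (z, t))%:R.
Proof.
rewrite (big_pauli1 (fun p => (p x y)^* * p z t)) !mxE.
case: (ord2_cases x) => ->; case: (ord2_cases y) => ->;
case: (ord2_cases z) => ->; case: (ord2_cases t) => -> /=;
rewrite ?(rmorphB, rmorphD, rmorphM, rmorphN, rmorph0, rmorph1) /=;
rewrite ?conjCi; ring: (sqrCi R[i]). Qed.

Lemma pauli1_orth (p q : pauli1 R) :
  \sum_x \sum_y (val p x y)^* * val q x y = 2 * (p == q)%:R.
Proof.
have := pauli1_uniq; rewrite /= !inE !negb_or -!andbA andbT.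
move=> /and5P[ZY Z1 ZX Y1 /andP[YX IX]].
case: p q => [A hA] [B hB]; rewrite -val_eqE /= !big_ord_recl !big_ord0.
move: hA hB; rewrite !inE -!orbA.
move=> /or4P[] /eqP-> /or4P[] /eqP->; rewrite ?eqxx
  ?[_ == pauliZ R]eq_sym ?[1%:M == pauliY R]eq_sym ?[pauliX R == _]eq_sym
  ?(negPf ZY, negPf Z1, negPf ZX, negPf Y1, negPf YX, negPf IX) !mxE /=;
rewrite ?(rmorphB, rmorphD, rmorphM, rmorphN, rmorph0, rmorph1) /=;
rewrite ?conjCi; ring: (sqrCi R[i]).
Qed.


Lemma sum_prod_digits (n : nat) (F : 'I_n -> 'I_2 -> R[i]) :
  \sum_a \prod_(j < n) F j (digits a j) = \prod_(j < n) \sum_x F j x.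
Proof.
rewrite bigA_distr_bigA /= [RHS](reindex (@digits n)) //.
exact/onW_bij/digits_bij.
Qed.

Lemma prod_eq_ffun (I T : finType) (P Q : {ffun I -> T}) :
  \prod_i (P i == Q i)%:R = (P == Q)%:R :> R[i].
Proof.
have [-> | neqPQ] := eqVneq P Q; first by rewrite big1 // => i _; rewrite eqxx.
have /existsP[i /negPf neq] : [exists i, P i != Q i].
  apply: contraNT neqPQ => /existsPn eqPQ.
  by apply/eqP/ffunP => i; apply/eqP; rewrite -[_ == _]negbK eqPQ.
by rewrite (bigD1 i) //= neq mul0r.
Qed.

(* Labels of operators; distinct labels give distinct operators by
   orthogonality, so sums over operators can be taken over labels. *)
Definition string_op (n : nat) (P : {ffun 'I_n -> pauli1 R}) :=
  tens (fun j => val (P j)).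

Lemma string_op_orth (n : nat) (P Q : {ffun 'I_n -> pauli1 R}) :
  \sum_a \sum_b (string_op P a b)^* * string_op Q a b
  = (2 ^ n)%:R * (P == Q)%:R.
Proof.
under eq_bigr => a _.
  under eq_bigr => b _ do rewrite !tensE rmorph_prod -big_split /=.
  (* The column sum factors over qubits with the row digits fixed; the row sum factors
     afterwards. *)
  rewrite (sum_prod_digits (fun j y =>
    (val (P j) (digits a j) y)^* * val (Q j) (digits a j) y)).
  over.
rewrite (sum_prod_digits (fun j x =>
  \sum_y (val (P j) x y)^* * val (Q j) x y)).
under eq_bigr => j _ do rewrite pauli1_orth.
by rewrite big_split /= prod_eq_ffun prodr_const card_ord natrX.
Qed.

Lemma string_op_inj (n : nat) : injective (@string_op n).
Proof.
move=> P Q eqPQ; apply/eqP; have := string_op_orth P Q.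
rewrite eqPQ string_op_orth eqxx => /(mulfI _).
have /[swap]/[apply] : (2 ^ n)%:R != 0 :> R[i] by rewrite pnatr_eq0 expn_eq0.
by case: (P == Q) => // /eqP; rewrite oner_eq0.
Qed.

Lemma big_paulis (n : nat) (F : 'M[R[i]]_(2 ^ n) -> R[i]) :
  \sum_(C : paulis R n) F (val C)
  = \sum_(P : {ffun 'I_n -> pauli1 R}) F (string_op P).
Proof.
rewrite -(big_seq_fsetE _ _ predT F) /paulis big_imfset /=.
  by rewrite big_enum.
by move=> P Q _ _; apply: string_op_inj.
Qed.

Lemma paulis_complete (n : nat) (a b c e : 'I_(2 ^ n)) :
  \sum_(C : paulis R n) (val C a b)^* * val C c e
  = (2 ^ n)%:R * ((a, b) == (c, e))%:R.
Proof.
rewrite (big_paulis (fun C => (C a b)^* * C c e)).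
under eq_bigr => P _ do rewrite !tensE rmorph_prod -big_split /=.
transitivity (\prod_(j < n) \sum_(p : pauli1 R)
    (val p (digits a j) (digits b j))^* * val p (digits c j) (digits e j)).
  by rewrite bigA_distr_bigA.
under eq_bigr => j _ do rewrite pauli1_complete xpair_eqE -mulnb natrM.
rewrite !big_split /= !prod_eq_ffun prodr_const card_ord natrX -natrM mulnb.
by rewrite !(bij_eq (digits_bij n)).
Qed.

Lemma paulis_orth (n : nat) (P Q : paulis R n) :
  \sum_a \sum_b (val P a b)^* * val Q a b = (2 ^ n)%:R * (P == Q)%:R.
Proof.
rewrite -val_eqE.
have /imfsetP[p _ ->] := valP P; have /imfsetP[q _ ->] := valP Q.
by rewrite string_op_orth (inj_eq (@string_op_inj n)).
Qed.

End Pauli.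

Section Words.
Variables (C : numClosedFieldType) (d : nat) (T : finType).
Variable op : T -> 'M[C]_d.

Local Notation adj A := (map_mx Num.conj A^T).

Hypothesis op_complete : forall a b c e,
  \sum_t (op t a b)^* * op t c e = d%:R * ((a, b) == (c, e))%:R.
Hypothesis op_orth : forall s t,
  \sum_a \sum_b (op s a b)^* * op t a b = d%:R * (s == t)%:R.

Lemma tr_adj_mul m n (X Y : 'M[C]_(m, n)) :
  \tr (adj X *m Y) = \sum_a \sum_b (X a b)^* * Y a b.
Proof.
rewrite exchange_big; apply: eq_bigr => b _; rewrite mxE.
by apply: eq_bigr => a _; rewrite !mxE.
Qed.

Lemma adj_mul m n p (X : 'M[C]_(m, n)) (Y : 'M[C]_(n, p)) :
  adj (X *m Y) = adj Y *m adj X.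
Proof. by rewrite trmx_mul map_mxM. Qed.

Lemma twirl (X : 'M[C]_d) :
  \sum_t adj (op t) *m X *m op t = (d%:R * \tr X)%:M.
Proof.
apply/matrixP => b e; rewrite summxE.
transitivity (\sum_c \sum_a X a c * \sum_t ((op t a b)^* * op t c e)).
  under [RHS]eq_bigr => c _.
    under eq_bigr => a _ do rewrite mulr_sumr.
    rewrite exchange_big /=; over.
  rewrite [RHS]exchange_big; apply: eq_bigr => t _; rewrite mxE.
  apply: eq_bigr => c _; rewrite mxE mulr_suml.
  by apply: eq_bigr => a _; rewrite !mxE mulrCA mulrA.
rewrite mxE mulr_sumr -sumrMnl; apply: eq_bigr => c _.
under eq_bigr => a _ do rewrite op_complete.
rewrite (bigD1 c) //= big1 => [|a /negPf neq].
  by rewrite addr0 xpair_eqE eqxx /= mulrA [X c c * _]mulrC mulr_natr.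
by rewrite xpair_eqE neq !mulr0.
Qed.

Lemma parseval (X Y : 'M[C]_d) :
  \sum_t (\tr (X *m op t))^* * \tr (Y *m op t) = d%:R * \tr (adj X *m Y).
Proof.
have trE (Z : 'M[C]_d) t : \tr (Z *m op t) = \sum_p Z p.1 p.2 * op t p.2 p.1.
  rewrite -(pair_bigA _ (fun a b => Z a b * op t b a)).
  by apply: eq_bigr => a _; rewrite mxE.
transitivity (\sum_p \sum_q (X p.1 p.2)^* * Y q.1 q.2
    * \sum_t (op t p.2 p.1)^* * op t q.2 q.1).
  under [RHS]eq_bigr => p _.
    under eq_bigr => q _ do rewrite mulr_sumr.
    rewrite exchange_big /=; over.
  rewrite [RHS]exchange_big; apply: eq_bigr => t _.
  rewrite !trE rmorph_sum mulr_suml /=; apply: eq_bigr => p _.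
  rewrite mulr_sumr; apply: eq_bigr => q _.
  by rewrite rmorphM mulrACA.
rewrite tr_adj_mul [in RHS]pair_bigA mulr_sumr; apply: eq_bigr => -[a b] _ /=.
rewrite (bigD1 (a, b)) //= op_complete eqxx big1 => [|[c e]].
  by rewrite addr0 mulr1 mulrC.
by rewrite op_complete eq_sym !xpair_eqE andbC => /negPf ->; rewrite !mulr0.
Qed.

Definition word k (A B : 'I_k -> T) : 'M[C]_d :=
  \big[mulmx/1%:M]_(j < k) (op (A j) *m op (B j)).

Lemma word_recl k (A : 'I_k.+1 -> T) (B : {ffun 'I_k.+1 -> T}) :
  word A B = op (A ord0) *m op (B ord0)
    *m word (fun j => A (lift ord0 j)) [ffun j => B (lift ord0 j)].
Proof.
rewrite /word big_ord_recl; congr (_ *m _).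
by apply: eq_bigr => j _; rewrite ffunE.
Qed.

Lemma sum_adj_word k (A' A : 'I_k -> T) :
  \sum_(B : {ffun 'I_k -> T}) adj (word A' B) *m word A B
  = ((d ^ (2 * k))%:R * \prod_(j < k) (A' j == A j)%:R)%:M.
Proof.
elim: k A' A => [|k IHk] A' A.
  rewrite (eq_bigr (fun=> 1%:M)) => [|B _].
    by rewrite sumr_const card_ffun card_ord big_ord0 mulr1.
  by rewrite /word !big_ord0 trmx1 map_mx1 mulmx1.
under eq_bigr => B _ do rewrite !word_recl.
rewrite (sum_ffun_recl (fun b B =>
  adj (op (A' ord0) *m op b *m word (fun j => A' (lift ord0 j)) B)
  *m (op (A ord0) *m op b *m word (fun j => A (lift ord0 j)) B))).
rewrite exchange_big /=.
transitivity (\sum_(B : {ffun 'I_k -> T})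
    (d%:R * d%:R * (A' ord0 == A ord0)%:R)
    *: (adj (word (fun j => A' (lift ord0 j)) B)
        *m word (fun j => A (lift ord0 j)) B)).
  apply: eq_bigr => B _.
  transitivity (adj (word (fun j => A' (lift ord0 j)) B)
    *m (\sum_b adj (op b) *m (adj (op (A' ord0)) *m op (A ord0)) *m op b)
    *m word (fun j => A (lift ord0 j)) B).
    rewrite mulmx_sumr mulmx_suml; apply: eq_bigr => b _.
    by rewrite !adj_mul !mulmxA.
  by rewrite twirl tr_adj_mul op_orth mul_mx_scalar -scalemxAl mulrA.
rewrite -scaler_sumr IHk big_ord_recl scale_scalar_mx; congr _%:M.
by rewrite mulnS expnD !natrM; ring.
Qed.

Lemma sum_tr_word k (A' A : 'I_k -> T) : (0 < k)%N ->
  \sum_(B : {ffun 'I_k -> T}) (\tr (word A' B))^* * \tr (word A B)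
  = (d ^ (2 * k))%:R * \prod_(j < k) (A' j == A j)%:R.
Proof.
case: k A' A => // k A' A _.
under eq_bigr => B _ do rewrite !word_recl.
rewrite (sum_ffun_recl (fun b B =>
  (\tr (op (A' ord0) *m op b *m word (fun j => A' (lift ord0 j)) B))^*
  * \tr (op (A ord0) *m op b *m word (fun j => A (lift ord0 j)) B))).
rewrite exchange_big /=.
transitivity (d%:R * \tr (adj (op (A' ord0))
    *m (\sum_(B : {ffun 'I_k -> T})
          adj (word (fun j => A' (lift ord0 j)) B)
          *m word (fun j => A (lift ord0 j)) B)
    *m op (A ord0))).
  rewrite mulmx_sumr mulmx_suml linear_sum mulr_sumr /=.
  apply: eq_bigr => B _.
  under eq_bigr => b _ do rewrite !(mxtrace_mulC (_ *m op b)) !mulmxA.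
  by rewrite parseval adj_mul !mulmxA.
rewrite sum_adj_word mul_mx_scalar -scalemxAl linearZ /= tr_adj_mul op_orth.
by rewrite big_ord_recl mulnS expnD !natrM; ring.
Qed.

End Words.

Theorem theorem2 (R : realType) (n k : nat) (k_ge1 : (1 <= k)%N)
    (A A' : {ffun 'I_k -> paulis R n}) :
  \sum_(C : {ffun 'I_k -> paulis R n}) Mdag C A' * Mtr A C
  = ((2 ^ n) ^ (2 * k))%:R * \prod_(j < k) delta (A' j) (A j).
Proof.
(* [conjc] in [Mdag] is convertible to the [Num.conj] of the lemmas. *)
exact: (@sum_tr_word _ _ _ (fun P : paulis R n => val P)
  (@paulis_complete R n) (@paulis_orth R n) k A' A k_ge1).
Qed.
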